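(* For every positive integer $k$ there exists a tree $T_k$ such that $|V(T_k)|=2^{O(k\log k)}$ and $h(T_k)\ge k$. (Here the implied constant in $O(\cdot)$ is absolute, i.e. there is a constant $C$ such that $|V(T_k)|\le 2^{Ck\log k}$ for all $k\ge2$.)
   Context: Hunters \& Rabbit game on a graph $G$ with $k$ hunters: a hunters' strategy is a sequence $\mathcal H=(H_1,H_2,\ldots)$ of sets $H_i\subseteq V(G)$ with $|H_i|\le k$. A rabbit's strategy is a sequence $(r_0,r_1,\ldots)$ of vertices with $r_i$ adjacent to $r_{i-1}$ for all $i\ge1$. $\mathcal H$ is winning if for every rabbit's strategy there is $i\ge1$ with $r_{i-1}\in H_i$. The hunter number $h(G)$ is the minimum $k$ such that $k$ hunters have a winning strategy on $G$. *)

(* Defs.v *)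
From mathcomp Require Import all_boot.
From mathcomp Require Import boolp.

Set Implicit Arguments.
Unset Strict Implicit.
Unset Printing Implicit Defensive.

Record sgraph := SGraph {
  vertex :> finType;
  adj : rel vertex;
  adj_sym : symmetric adj;
  adj_irrefl : irreflexive adj
}.

(* Cycles of a simple graph have length at least 3: the duplicate-free closed
   walk [:: x; y] along an edge is a ucycle but not a graph cycle. *)
Definition acyclic (G : sgraph) : Prop :=
  forall c : seq G, 2 < size c -> ~ ucycle (@adj G) c.

Definition connected_graph (G : sgraph) : Prop :=
  0 < #|G| /\ forall x y : G, connect (@adj G) x y.

Definition is_tree (G : sgraph) : Prop := connected_graph G /\ acyclic G.

(* Hunters' sequences are shifted by one: H i is the set shot at in round
   i + 1, when the rabbit is at r i. *)
Definition hunter_strategy (G : sgraph) (k : nat) (H : nat -> {set G}) : Prop :=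
  forall i, #|H i| <= k.

Definition rabbit_strategy (G : sgraph) (r : nat -> G) : Prop :=
  forall i, adj (r i) (r i.+1).

Definition winning (G : sgraph) (H : nat -> {set G}) : Prop :=
  forall r : nat -> G, rabbit_strategy r -> exists i, r i \in H i.

Definition hunters_win (G : sgraph) (k : nat) : Prop :=
  exists2 H : nat -> {set G}, hunter_strategy k H & winning H.

Lemma ex_hunters_win (G : sgraph) : exists k, `[< hunters_win G k >].
Proof.
exists #|G|; apply/asboolP; exists (fun _ => [set: G]) => [i|r _].
  exact: max_card.
by exists 0; rewrite inE.
Qed.

(* An edgeless graph admits no rabbit strategy, so its hunter number is 0. *)
Definition hunter_number (G : sgraph) : nat := ex_minn (ex_hunters_win G).

(* Main.v *)
Require Import Defs.
From mathcomp Require Import all_boot all_order all_algebra.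
From mathcomp Require Import reals exp.
From mathcomp Require Import boolp zify ring.
Set Implicit Arguments.
Unset Strict Implicit.
Unset Printing Implicit Defensive.
Import Order.TTheory GRing.Theory Num.Theory.

(* The tree is the subdivision of the binary heap on {0, ..., 2^D - 1}, where
   y hangs below y/2. Seen every second round, the contaminated set is a set F
   of heap edges; after the next two shots every node touched by F and not shot
   contaminates all its incident edges. Hence F gains at least a third of the
   number of edges y at which membership in F differs between y and y/2, up to
   O(k) losses. Summation by parts shows that #|F| depends only on whether
   0 is in F and on the depths and signs of these changes, so at most
   O(D)^(8k) sizes occur with at most 8k changes. As soon as
   k O(D)^(8k) < 2^D, which allows D = O(k log k), some window of width 2k
   avoids all these sizes, and F can never shrink through that window. *)

(** * From sets of contaminated vertices to an escaping rabbit *)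

Section SurvivingRabbit.
Variables (G : sgraph) (H : nat -> {set G}).

Fixpoint survives (m i : nat) (x : G) : bool :=
  if m is m'.+1 then
    (x \notin H i) && [exists y, adj x y && survives m' i.+1 y]
  else true.

Definition contaminate (i : nat) (A : {set G}) : {set G} :=
  [set y | [exists x in A :\: H i, adj x y]].

Fixpoint contaminated (m i : nat) (A : {set G}) : {set G} :=
  if m is m'.+1 then contaminated m' i.+1 (contaminate i A) else A.

Lemma contaminated_survives m i (A : {set G}) y :
  y \in contaminated m i A -> exists2 x, x \in A & survives m i x.
Proof.
elim: m i A => [|m IHm] i A /=; first by exists y.
case/IHm => z; rewrite inE => /exists_inP[x]; rewrite inE => /andP[xH xA] xz sz.
by exists x => //; rewrite xH; apply/existsP; exists z; rewrite xz.
Qed.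

Lemma survives_le m n i x : m <= n -> survives n i x -> survives m i x.
Proof.
elim: m n i x => [|m IHm] [|n] i x //= mn /andP[-> /existsP[y /andP[xy sy]]].
by apply/existsP; exists y; rewrite xy (IHm n).
Qed.

(* Koenig's lemma: a candidate start dying after d x rounds for each x would
   contradict survival for the maximum of d. *)
Lemma survives_forever (P : pred G) i :
  (forall m, exists2 x, P x & survives m i x) ->
  exists2 x, P x & forall m, survives m i x.
Proof.
move=> ex_surv; apply: contrapT => no_surv.
have death x : exists m, P x -> ~~ survives m i x.
  have [Px|_] := boolP (P x); last by exists 0.
  apply: contrapT => /forallNP sx; apply: no_surv; exists x => // m.
  by apply: contrapT => /negP ns; exact: (sx m).
have [d dP] := choice death.
have [x Px] := ex_surv (\max_x d x).
by move=> /(survives_le (leq_bigmax x)); rewrite (negPf (dP x Px)).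
Qed.

(** By compactness some start survives every finite horizon, and a vertex with this property always
    has a neighbour with it in the next round; the rabbit keeps moving to such neighbours. *)
Lemma escaping_rabbit (A : {set G}) :
  (forall m, contaminated m 0 A != set0) -> ~ winning H.
Proof.
move=> contA winH.
have [|x0 _ x0P] := @survives_forever (mem A) 0.
  by move=> m; have /set0Pn[y /contaminated_survives] := contA m.
have step i x : (forall m, survives m i x) ->
    exists2 y, adj x y & forall m, survives m i.+1 y.
  move=> sx; apply: survives_forever => m.
  by have /andP[_ /existsP[y /andP[xy sy]]] := sx m.+1; exists y.
(* The default [x] is never reached from a vertex that survives every horizon. *)
pose next i x :=
  odflt x [pick y | adj x y && `[< forall m, survives m i.+1 y >]].
have nextP i x : (forall m, survives m i x) ->
    adj x (next i x) /\ forall m, survives m i.+1 (next i x).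
  move=> /step[y xy sy]; rewrite /next; case: pickP => /= [z /andP[xz /asboolP]//|].
  by move=> /(_ y); rewrite xy => /asboolPn; case.
pose r := fix r i := if i is j.+1 then next j (r j) else x0.
have rP i : forall m, survives m i (r i).
  by elim: i => [//|i IHi] /=; exact: (nextP _ _ IHi).2.
have [|i] := winH r; first by move=> i; exact: (nextP _ _ (rP i)).1.
by have /andP[/negPf->] := rP i 1.
Qed.

End SurvivingRabbit.

(** * Trees recognised by a rank that decreases towards the root *)

Section RankedGraphs.
Variables (G : sgraph) (rank : G -> nat).

(** At a vertex of maximal rank on a cycle, both cycle neighbours have smaller rank, so they
    coincide; on a duplicate-free cycle of length at least 3 they are distinct. *)
Lemma ranked_acyclic :
  (forall x y : G, adj x y -> rank x <> rank y) ->
  (forall x y z : G, adj x y -> adj x z -> rank y < rank x -> rank z < rank x ->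
     y = z) ->
  acyclic G.
Proof.
move=> rank_neq parent_uniq c c2 /andP[cyc_c uniq_c].
have [x0 x0c] : {x0 | x0 \in c} by case: c c2 {cyc_c uniq_c} => // x c; exists x; rewrite inE eqxx.
case: (@arg_maxnP _ x0 (mem c) rank x0c) => x /= xc xmax.
have [i p rot_c] := rot_to xc.
have cycp : cycle (@adj G) (x :: p) by rewrite -rot_c rot_cycle.
have uniqp : uniq (x :: p) by rewrite -rot_c rot_uniq.
have sizep : 2 < size (x :: p) by rewrite -rot_c size_rot.
have maxp y : y \in p -> adj x y -> rank y < rank x.
  move=> yp xy; rewrite ltn_neqAle; apply/andP; split.
    by apply/eqP => /esym; exact: rank_neq.
  by apply: xmax; rewrite /= -(mem_rot i) rot_c inE yp orbT.
case: p => [|y p] // in cycp uniqp sizep maxp {rot_c} *.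
case/lastP: p => [|p z] // in cycp uniqp sizep maxp *.
move: cycp; rewrite /= rcons_path last_rcons => /and3P[xy _].
rewrite adj_sym => xz.
have yz : y = z.
  apply: (parent_uniq x) => //; apply: maxp => //; rewrite ?mem_head //.
  by rewrite inE mem_rcons mem_head orbT.
by move: uniqp; rewrite yz /= mem_rcons mem_head /= andbF.
Qed.

Lemma ranked_connected (x0 : G) :
  (forall x, x != x0 -> exists2 y, adj x y & rank y < rank x) ->
  connected_graph G.
Proof.
move=> descend; split; first by apply/card_gt0P; exists x0.
have connect0 x : connect (@adj G) x x0.
  have [n] := ubnP (rank x); elim: n x => // n IHn x xn.
  have [->|/descend[y xy yx]] := eqVneq x x0; first exact: connect0.
  apply: connect_trans (connect1 xy) (IHn y _); lia.
move=> x y; apply: connect_trans (connect0 x) _.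
by rewrite (sym_connect_sym (@adj_sym G)).
Qed.

End RankedGraphs.

(** * Summation by parts along the binary heap *)

Section PrefixSums.
Local Open Scope ring_scope.

Lemma sum_half (c : nat -> int) N :
  \sum_(0 <= y < N.*2) c y./2 = 2 * \sum_(0 <= y < N) c y.
Proof.
elim: N => [|N IHN]; first by rewrite !big_geq ?mulr0.
rewrite doubleS big_nat_recr //= big_nat_recr //= IHN [in RHS]big_nat_recr //=.
by rewrite mulrDr doubleK uphalf_double -addrA; congr (_ + _); lia.
Qed.

(** Each [c y] is [c 0] plus the changes on the path from the root to [y]. A change at [y > 0] of
    depth l is thus counted once for each of the 2^(D-l) - 1 nodes of its subtree; the change at 0
    vanishes. *)
Lemma prefix_sum_changes (c : nat -> int) D :
  \sum_(0 <= y < 2 ^ D) c y =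
  (2 ^ D)%N%:Z * c 0 +
  \sum_(0 <= y < 2 ^ D) (c y - c y./2) * (2 ^ (D - trunc_log 2 y) - 1)%N%:Z.
Proof.
elim: D => [|D IHD]; first by rewrite !big_nat1 /= subrr mul0r addr0 mul1r.
pose e y := c y - c y./2.
have -> : \sum_(0 <= y < 2 ^ D.+1) c y =
    2 * \sum_(0 <= y < 2 ^ D) c y + \sum_(0 <= y < 2 ^ D.+1) e y.
  by rewrite /e sumrB expnS mul2n sum_half addrC subrK.
have -> : \sum_(0 <= y < 2 ^ D.+1) e y * (2 ^ (D.+1 - trunc_log 2 y) - 1)%N%:Z =
    2 * (\sum_(0 <= y < 2 ^ D) e y * (2 ^ (D - trunc_log 2 y) - 1)%N%:Z) +
    \sum_(0 <= y < 2 ^ D.+1) e y.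
  (* The added indices have depth D, hence coefficient 0. *)
  have -> : \sum_(0 <= y < 2 ^ D) e y * (2 ^ (D - trunc_log 2 y) - 1)%N%:Z =
      \sum_(0 <= y < 2 ^ D.+1) e y * (2 ^ (D - trunc_log 2 y) - 1)%N%:Z.
    rewrite [RHS](big_cat_nat (n := (2 ^ D)%N)) ?leq_exp2l //=.
    rewrite [X in _ + X]big1_seq ?addr0 // => y.
    rewrite mem_index_iota => /andP[_ /andP[yD yD1]].
    by rewrite (trunc_log_eq _ (_ : 2 ^ D <= y < 2 ^ D.+1)%N) ?yD ?subnn ?mulr0.
  rewrite mulr_sumr -big_split /=; apply: eq_big_nat => y /andP[_ yD].
  have yl : (trunc_log 2 y <= D)%N.
    have [->|y0] := posnP y; first by rewrite trunc_log0.
    by rewrite -ltnS -(@ltn_exp2l 2) // (leq_ltn_trans (trunc_logP _ y0)).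
  have p_gt0 := expn_gt0 2 (D - trunc_log 2 y).
  have -> : (2 ^ (D.+1 - trunc_log 2 y) - 1)%N%:Z =
      2 * (2 ^ (D - trunc_log 2 y) - 1)%N%:Z + 1 :> int.
    by rewrite subSn // expnS; lia.
  by rewrite mulrDr mulr1 mulrCA.
rewrite IHD -/e mulrDr addrA expnS PoszM mulrA; congr (_ + _ + _).
Qed.

End PrefixSums.

(** * Sizes of edge sets with few changes *)

Section HeapColourings.
Variable D : nat.

Lemma half_subproof (y : 'I_(2 ^ D)) : y./2 < 2 ^ D.
Proof. by have := ltn_ord y; lia. Qed.

Definition half_ord (y : 'I_(2 ^ D)) := Ordinal (half_subproof y).

Definition changes (F : {set 'I_(2 ^ D)}) : {set 'I_(2 ^ D)} :=
  [set y | (y \in F) != (half_ord y \in F)].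

Lemma in_changes (F : {set 'I_(2 ^ D)}) y :
  (y \in changes F) = ((y \in F) != (half_ord y \in F)).
Proof. by rewrite inE. Qed.

Lemma card_half_preimset (A : {set 'I_(2 ^ D)}) :
  #|[set y | half_ord y \in A]| <= 2 * #|A|.
Proof.
pose f (y : 'I_(2 ^ D)) := (odd y, half_ord y).
have f_inj : injective f.
  move=> x y [odd_xy half_xy]; apply/val_inj.
  by rewrite /= -(odd_double_half x) -(odd_double_half y) odd_xy half_xy.
rewrite -(card_imset _ f_inj) -[X in X * _]card_bool -cardsT -cardsX subset_leq_card //.
apply/subsetP => _ /imsetP[y yA ->]; rewrite !inE /=.
by rewrite inE in yA.
Qed.

(* The contribution to #|F| of a change of sign b at depth l; None is padding. *)
Definition jump (o : option (bool * 'I_D.+1)) : int :=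
  if o is Some (b, l) then
    ((if b then 1 else -1) * (2 ^ (D - l) - 1)%N%:Z)%R
  else 0%R.

Definition coded_size q (p : bool * q.-tuple (option (bool * 'I_D.+1))) : int :=
  ((2 ^ D)%N%:Z * p.1%:Z + \sum_(o <- p.2) jump o)%R.

(** Summation by parts is applied to the indicator of [F]: the code records whether 0 lies in [F],
    then sign and depth of each change, padded to length [q]. *)
Lemma card_coded q (F : {set 'I_(2 ^ D)}) :
  #|changes F| <= q -> exists p : bool * q.-tuple _, Posz #|F| = coded_size p.
Proof.
move=> Fq.
have yl (y : 'I_(2 ^ D)) : trunc_log 2 y < D.+1.
  have [->|y0] := posnP y; first by rewrite trunc_log0.
  by rewrite ltnS -(@leq_exp2l 2) // (leq_trans (trunc_logP _ y0)) // ltnW.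
pose o (y : 'I_(2 ^ D)) := Some (y \in F, Ordinal (yl y)).
pose s := [seq o y | y <- enum (changes F)] ++ nseq (q - #|changes F|) None.
have size_s : size s == q by rewrite size_cat size_map size_nseq -cardE subnKC.
have root_lt : 0 < 2 ^ D by rewrite expn_gt0.
exists (Ordinal root_lt \in F, Tuple size_s).
pose c y := Posz (y \in [seq val x | x in F]).
have cE (y : 'I_(2 ^ D)) : c y = Posz (y \in F)
  by rewrite /c mem_image //; exact: val_inj.
have -> : (#|F|%:Z = \sum_(0 <= y < 2 ^ D) c y)%R.
  rewrite big_mkord -sum1_card -natz natr_sum big_mkcond /=.
  by apply: eq_bigr => y _; rewrite cE; case: (y \in F).
rewrite prefix_sum_changes /coded_size -(cE (Ordinal root_lt)) /=.
congr (_ + _)%R.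
rewrite big_cat big_map /= [X in (_ + X)%R]big1_seq; last first.
  by move=> x /andP[_]; rewrite mem_nseq => /andP[_ /eqP->].
rewrite addr0 big_enum /= big_mkord [RHS]big_mkcond /=.
apply: eq_bigr => y _; rewrite (cE y) (cE (half_ord y)) in_changes.
by case: (y \in F); case: (half_ord y \in F); rewrite ?subrr ?mul0r.
Qed.

(** Pigeonhole: if each [t] had a set with at most [q] changes in its window, the code of that set's
    size and its offset in the window would determine [t], but there are fewer such pairs than
    values of [t]. *)
Lemma isoperimetric_threshold k q :
  2 * (2 * D + 3) ^ q * (2 * k) < 2 ^ D ->
  exists2 t, t < 2 ^ D & forall F : {set 'I_(2 ^ D)},
    t < #|F| + k -> #|F| <= t + k -> q < #|changes F|.
Proof.
move=> few; apply: contrapT => no_threshold.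
have code (t : 'I_(2 ^ D)) :
    exists ps : (bool * q.-tuple (option (bool * 'I_D.+1))) * 'I_(2 * k),
      (coded_size ps.1 + k%:Z = t.+1%:Z + ps.2%:Z)%R.
  apply: contrapT => no_code; apply: no_threshold; exists t => // F tF Ft.
  rewrite ltnNge; apply/negP => /card_coded[p pF]; apply: no_code.
  have s_lt : #|F| + k - t.+1 < 2 * k by lia.
  by exists (p, Ordinal s_lt); rewrite -pF /= -!PoszD subnKC.
have [f fP] := choice code.
have f_inj : injective f.
  move=> t u tu; apply/val_inj; have := fP t; have := fP u; rewrite tu => -> /=; lia.
have := leq_card f f_inj.
rewrite !card_prod card_tuple card_option !card_prod card_bool !card_ord.
by rewrite leqNgt (_ : (2 * D.+1).+1 = 2 * D + 3) ?few //; lia.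
Qed.

End HeapColourings.

(** * The game on the subdivided heap *)

Section SubdividedHeap.
Variable D : nat.

(* (true, x) is the midpoint of the edge from x up to x./2, and (false, v) is
   the heap node v. As 0./2 = 0, the edge 0 is a pendant edge at the node 0. *)
Definition incident (x v : 'I_(2 ^ D)) := (x == v) || (half_ord x == v).

Definition heap_adj : rel (bool * 'I_(2 ^ D)) := fun p q =>
  match p, q with
  | (true, x), (false, v) | (false, v), (true, x) => incident x v
  | _, _ => false
  end.

Lemma heap_adj_sym : symmetric heap_adj.
Proof. by move=> [[] x] [[] y]. Qed.

Lemma heap_adj_irrefl : irreflexive heap_adj.
Proof. by move=> [[] x]. Qed.

Definition heap_graph := SGraph heap_adj_sym heap_adj_irrefl.

(** The root is the pendant edge 0; the parent of node v is edge v, and the parent of an edge x > 0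
    is node x/2. *)
Definition heap_rank (p : heap_graph) : nat := (val p.2).*2 + ~~ p.1.

Lemma heap_is_tree : is_tree heap_graph.
Proof.
split.
  have root_lt : 0 < 2 ^ D by rewrite expn_gt0.
  apply: (@ranked_connected _ heap_rank (true, Ordinal root_lt)) => -[[] x] x_root.
    exists (false, half_ord x); first by rewrite /= /incident eqxx orbT.
    have x_gt0 : 0 < x.
      by rewrite lt0n; apply: contra_neq x_root => x0; congr pair; exact/val_inj.
    by rewrite /heap_rank /=; lia.
  exists (true, x); first by rewrite /= /incident eqxx.
  by rewrite /heap_rank /=; lia.
apply: (@ranked_acyclic _ heap_rank).
  by move=> [[] x] [[] y] //= _; rewrite /heap_rank /=; lia.
move=> [[] x] [[] y] [[] z] //=; rewrite /incident /heap_rank /=.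
- move=> /orP[/eqP<-|/eqP<-] /orP[/eqP<-|/eqP<-] //=; lia.
- by move=> /orP[/eqP<-|/eqP<-] /orP[/eqP zx|/eqP zx] //= yr zr;
    congr pair; apply/val_inj; move: zx => /(congr1 val) /=; lia.
Qed.

Definition edges (A : {set heap_graph}) : {set 'I_(2 ^ D)} :=
  [set x | (true, x) \in A].

Definition nodes (A : {set heap_graph}) : {set 'I_(2 ^ D)} :=
  [set x | (false, x) \in A].

Lemma card_edges A : #|edges A| <= #|A|.
Proof.
have inj_pair : injective (pair true : 'I_(2 ^ D) -> heap_graph) by move=> x y [].
rewrite -(card_imset _ inj_pair) subset_leq_card //.
by apply/subsetP => _ /imsetP[x xA ->]; rewrite inE in xA.
Qed.

Lemma card_nodes A : #|nodes A| <= #|A|.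
Proof.
have inj_pair : injective (pair false : 'I_(2 ^ D) -> heap_graph) by move=> x y [].
rewrite -(card_imset _ inj_pair) subset_leq_card //.
by apply/subsetP => _ /imsetP[x xA ->]; rewrite inE in xA.
Qed.

Variable H : nat -> {set heap_graph}.

Lemma two_rounds i (A : {set heap_graph}) x y v :
  y \in edges (A :\: H i) -> v \notin nodes (H i.+1) ->
  incident y v -> incident x v ->
  x \in edges (contaminate H i.+1 (contaminate H i A)).
Proof.
rewrite !inE => yA vH yv xv; apply/exists_inP; exists (false, v) => //.
rewrite !inE vH; apply/exists_inP; exists (true, y) => //.
by rewrite inE.
Qed.

(** Edges [y] and [half_ord y] meet at node [half_ord y]. If exactly one is in [F] and this node is
    not shot, the other is gained. So a change at [y] is charged to a shot node [half_ord y], to a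
    gained [y], or to a gained [half_ord y]; the first and last are each charged by at most two
    [y]. *)
Lemma card_changes_gain i (A : {set heap_graph}) :
  let F := edges (A :\: H i) in
  let F2 := edges (contaminate H i.+1 (contaminate H i A)) in
  #|changes F| <= 2 * #|nodes (H i.+1)| + 3 * #|F2 :\: F|.
Proof.
set F := edges (A :\: H i); set F2 := edges (contaminate _ _ _) => /=.
set S := nodes _; set gain := F2 :\: F.
have changesS : changes F \subset
    [set y | half_ord y \in S] :|: (gain :|: [set y | half_ord y \in gain]).
  apply/subsetP => y; rewrite in_changes => changed_y.
  have [yS|yS] := boolP (half_ord y \in S); first by rewrite in_setU inE yS.
  have yv : incident y (half_ord y) by rewrite /incident eqxx orbT.
  have vv : incident (half_ord y) (half_ord y) by rewrite /incident eqxx.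
  have [yF|yF] := boolP (y \in F).
    have vF : half_ord y \notin F by move: changed_y; rewrite yF; case: (_ \in F).
    have vF2 : half_ord y \in F2 := two_rounds yF yS yv vv.
    have v_gain : half_ord y \in gain by rewrite in_setD vF.
    by rewrite !in_setU; apply/or3P/Or33; rewrite inE.
  have vF : half_ord y \in F.
    by move: changed_y; rewrite (negPf yF); case: (_ \in F).
  have yF2 : y \in F2 := two_rounds vF yS vv yv.
  have y_gain : y \in gain by rewrite in_setD yF.
  by rewrite !in_setU y_gain orbT.
apply: leq_trans (subset_leq_card changesS) _.
apply: leq_trans (leq_card_setU _ _) (leq_add (card_half_preimset _) _).
apply: leq_trans (leq_card_setU _ _) _.
by rewrite (mulSn 2) leq_add2l card_half_preimset.
Qed.

(** Each of the two shots costs at most [k] edges. If more than [t + k] edges remain after the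
    first, the second is harmless. Otherwise [F] lies in the window, and its more than 8k = 2k +
    3(2k) changes force a gain above 2k, which outweighs both losses. *)
Lemma edges_stay_above k t i (A : {set heap_graph}) :
  (forall j, #|H j| <= k) ->
  (forall F : {set 'I_(2 ^ D)},
     t < #|F| + k -> #|F| <= t + k -> 8 * k < #|changes F|) ->
  t < #|edges A| ->
  t < #|edges (contaminate H i.+1 (contaminate H i A))|.
Proof.
move=> Hk threshold tA.
set F2 := edges _; pose F := edges (A :\: H i).
have AF : #|edges A| <= #|F| + k.
  have sub : edges A \subset F :|: edges (H i).
    by apply/subsetP => x; rewrite !inE => ->; rewrite andbT orNb.
  apply: leq_trans (subset_leq_card sub) _.
  apply: leq_trans (leq_card_setU _ _) _.
  by rewrite leq_add2l (leq_trans (card_edges _)).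
have Sk : #|nodes (H i.+1)| <= k := leq_trans (card_nodes _) (Hk _).
(* A rabbit on edge [x] can step to node [x] and back, so a shot node removes at most its own edge
   from [F]. *)
have FS : F :\: nodes (H i.+1) \subset F2 :&: F.
  apply/subsetP => x /setDP[xF xS]; rewrite inE xF andbT.
  by apply: (two_rounds xF xS); rewrite /incident eqxx.
have FF2 : #|F| <= #|F2 :&: F| + k.
  have := subset_leq_card FS; have := cardsID (nodes (H i.+1)) F.
  have := subset_leq_card (subsetIr F (nodes (H i.+1))); lia.
have F2E := cardsID F F2.
have := card_changes_gain i A; rewrite -/F -/F2.
by have [Ft|tF] := leqP #|F| (t + k); first have := threshold F; lia.
Qed.

Lemma hunters_lose k t :
  t < 2 ^ D ->
  (forall F : {set 'I_(2 ^ D)},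
     t < #|F| + k -> #|F| <= t + k -> 8 * k < #|changes F|) ->
  hunter_strategy k H -> ~ winning H.
Proof.
move=> tD threshold Hk.
(* The bound on edges returns only every second round; the set in between is nonempty because an
   empty set would contaminate nothing in the next round. *)
have above m i (A : {set heap_graph}) : t < #|edges A| ->
    contaminated H m i A != set0 /\ contaminated H m.+1 i A != set0.
  have edges_neq0 (B : {set heap_graph}) : t < #|edges B| -> B != set0.
    by move=> tB; rewrite -card_gt0 (leq_trans _ (card_edges B)) // (leq_ltn_trans _ tB).
  elim/ltn_ind: m i A => -[|[|m]] IHm i A tA.
  - split; first exact: edges_neq0.
    have := edges_neq0 _ (edges_stay_above i Hk threshold tA).
    apply: contra_neq => /= ->; apply/setP => x; rewrite !inE.
    by apply/exists_inP => -[y]; rewrite !inE andbF.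
  - by split; [have [] := IHm 0 isT i A tA | exact/edges_neq0/edges_stay_above].
  - by have [? ?] := IHm m (leqnSn _) i.+2 _ (edges_stay_above i Hk threshold tA).
apply: (@escaping_rabbit _ _ setT) => m; apply: (above m 0 setT _).1.
suff -> : edges setT = setT by rewrite cardsT card_ord.
by apply/setP => x; rewrite !inE.
Qed.

End SubdividedHeap.

(** * Choice of the depth and the final estimate *)

Lemma heap_hunter_number D k :
  2 * (2 * D + 3) ^ (8 * k) * (2 * k) < 2 ^ D -> k < hunter_number (heap_graph D).
Proof.
move=> /isoperimetric_threshold[t tD threshold].
rewrite ltnNge; apply/negP; rewrite /hunter_number.
case: ex_minnP => m /asboolP[H Hm winH] _ mk.
by apply: (hunters_lose tD threshold) winH => i; exact: leq_trans (Hm i) mk.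
Qed.

(** As k and l are below 2^l, the base is at most 2^(12l), so the power is at most 2^(96kl); the
    remaining factor 2^(4kl) exceeds 4k. *)
Lemma depth_bound k l : 0 < k -> 0 < l -> k < 2 ^ l ->
  2 * (2 * (100 * k * l) + 3) ^ (8 * k) * (2 * k) < 2 ^ (100 * k * l).
Proof.
move=> k0 l0 kl.
have base : 2 * (100 * k * l) + 3 <= 2 ^ (12 * l).
  have l2 := ltn_expl l (ltnSn 1).
  have l10 : 2 ^ 10 <= 2 ^ (10 * l) by rewrite leq_exp2l //; lia.
  have -> : 2 ^ (12 * l) = 2 ^ (10 * l) * (2 ^ l * 2 ^ l).
    by rewrite -!expnD; congr (_ ^ _); lia.
  have kl2 : k * l <= 2 ^ l * 2 ^ l by rewrite leq_mul // ltnW.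
  apply: leq_trans (leq_mul l10 kl2); rewrite -mulnA.
  have : 0 < k * l by rewrite muln_gt0 k0.
  by set kl' := k * l; rewrite (_ : 2 ^ 10 = 1024) //; lia.
have pow : (2 * (100 * k * l) + 3) ^ (8 * k) <= 2 ^ (96 * (k * l)).
  have -> : 96 * (k * l) = 12 * l * (8 * k) by lia.
  by rewrite [leqRHS]expnM leq_exp2r //; lia.
have small : 4 * k < 2 ^ (4 * (k * l)).
  have l4 : 2 ^ (2 + l) <= 2 ^ (4 * (k * l)).
    by rewrite leq_exp2l //; have := leq_pmull l k0; lia.
  by apply: leq_trans l4; rewrite expnD; lia.
have -> : 2 ^ (100 * k * l) = 2 ^ (96 * (k * l)) * 2 ^ (4 * (k * l)).
  by rewrite -expnD -mulnDl mulnA.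
apply: leq_ltn_trans (_ : 2 ^ (96 * (k * l)) * (4 * k) < _).
  by rewrite mulnAC mulnC leq_mul //; lia.
by rewrite ltn_mul2l expn_gt0.
Qed.

Local Open Scope ring_scope.

Theorem theorem14 (R : realType) :
  exists C : R, forall k : nat, (0 < k)%N ->
    exists T : sgraph,
      [/\ is_tree T,
          (2 <= k)%N -> #|T|%:R <= 2 `^ (C * k%:R * ln k%:R)
        & (k <= hunter_number T)%N].
Proof.
have ln2 : 0 < ln 2 :> R by rewrite ln_gt0 // ltr1n.
(* The tree has 2^(100kl+1) vertices. For k >= 2, [l] is at most twice [trunc_log 2 k], so the
   exponent is at most 202 k [trunc_log 2 k], and [trunc_log 2 k] is at most ln k / ln 2. *)
exists (202 / ln 2) => k k0.
pose l := (trunc_log 2 k).+1.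
have kl : (k < 2 ^ l)%N by exact: trunc_log_ltn.
exists (heap_graph (100 * k * l)); split.
- exact: heap_is_tree.
- move=> k2.
  have lk : (trunc_log 2 k)%:R * ln 2 <= ln k%:R :> R.
    rewrite mulrC mulr_natr -lnXn ?ltr0n // ler_ln ?posrE ?exprn_gt0 ?ltr0n //.
    by rewrite -natrX ler_nat trunc_logP.
  have log_gt0 : (0 < trunc_log 2 k)%N by rewrite trunc_log_gt0.
  rewrite card_prod card_bool card_ord -expnS natrX -powR_mulrn ?ler0n //.
  apply: ler_powR; first by rewrite ler1n.
  have : (100 * k * l).+1%:R <= 202 * k%:R * (trunc_log 2 k)%:R :> R.
    by rewrite -!natrM ler_nat /l; nia.
  move/le_trans; apply.
  rewrite -(ler_pM2r ln2) -[leRHS]mulrA -[leLHS]mulrA.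
  have -> : 202 / ln 2 * k%:R * (ln k%:R * ln 2) = 202 * k%:R * ln k%:R :> R.
    by field; rewrite gt_eqF.
  by rewrite ler_wpM2l // mulr_ge0 ?ler0n.
- exact/ltnW/heap_hunter_number/depth_bound.
Qed.
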